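(* Let $\alpha$ stand for one of the symbols $\leq\omega$, $<\omega$, or $\leq n$ for some $n\in\omega$. Let $X$ be an uncountable abelian Polish group and let $B\subseteq X$ be a Borel set. Then the following are equivalent: (a) $B$ is Haar-$[2^\omega]^{\alpha}$; (b) there is a Cantor set $D\subseteq X$ with $(D-x)\cap B\in[X]^\alpha$ for each $x\in X$; (c) there is a Cantor set $D\subseteq X$ such that for any $S\subseteq D$ with $S\notin[X]^\alpha$ we have $\bigcap_{s\in S}(B-s)=\emptyset$.
   Context: $\omega=\{0,1,2,\ldots\}$. A Cantor set is a homeomorphic copy of $2^\omega$. For a set $Y$, $[Y]^{\leq\omega}$, $[Y]^{<\omega}$ and $[Y]^{\leq n}$ denote the families of at most countable subsets, finite subsets, and subsets of cardinality at most $n$ of $Y$, respectively. A semi-ideal on a set is a collection of subsets closed under taking subsets. For a semi-ideal $\mathcal{I}$ on $2^\omega$, a subset $A$ of an abelian Polish group $X$ is Haar-$\mathcal{I}$ if there are a Borel set $B\subseteq X$ with $A\subseteq B$ and a continuous map $f\colon 2^\omega\to X$ with $f^{-1}[B+x]\in\mathcal{I}$ for all $x\in X$. *)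

(* Defs.v *)
From HB Require Import structures.
From mathcomp Require Import all_boot all_order all_algebra.
From mathcomp Require Import all_classical all_reals topology tvs cantor.
From mathcomp Require Import measurable_structure.

Set Implicit Arguments.
Unset Strict Implicit.
Unset Printing Implicit Defensive.

Import GRing.Theory.

Local Open Scope classical_set_scope.
Local Open Scope ring_scope.

Definition homeomorphic (T U : topologicalType) : Prop :=
  exists (f : T -> U) (g : U -> T),
    [/\ continuous f, continuous g, cancel f g & cancel g f].

Definition separable (T : topologicalType) : Prop :=
  exists2 A : set T, countable A & dense A.

Definition complete_space (T : uniformType) : Prop :=
  forall F : set_system T, ProperFilter F -> cauchy F -> exists x : T, F --> x.

(* The metric is only required to exist: it need not be translation invariant.
   [R] is just the type in which distances take their values. *)
Definition completely_metrizable (R : realType) (T : topologicalType) : Prop :=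
  exists2 M : metricType R, complete_space M & homeomorphic T M.

Definition polish (R : realType) (T : topologicalType) : Prop :=
  separable T /\ completely_metrizable R T.

Definition borel (T : topologicalType) (A : set T) : Prop := <<s open >> A.

(* [D] is coerced to the subtype [{x | x \in D}] with the subspace topology. *)
Definition cantor_set (T : topologicalType) (D : set T) : Prop :=
  homeomorphic cantor_space D.

(* The symbols "<= omega", "< omega" and "<= n". *)
Inductive size_bound : Type :=
  | LeOmega
  | LtOmega
  | LeNat of nat.

Definition sets_of_size (T : Type) (alpha : size_bound) : set (set T) :=
  match alpha with
  | LeOmega => [set A | countable A]
  | LtOmega => [set A | finite_set A]
  | LeNat n => [set A | (A #<= `I_n)%card]
  end.

Definition semi_ideal (T : Type) (I : set (set T)) : Prop :=
  forall A B : set T, A `<=` B -> I B -> I A.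

Lemma semi_ideal_sets_of_size (T : Type) (alpha : size_bound) :
  semi_ideal (@sets_of_size T alpha).
Proof.
move=> A B AB; case: alpha => [|| n] /=.
- exact: sub_countable (subset_card_le AB).
- exact: sub_finite_set.
- exact: card_le_trans (subset_card_le AB).
Qed.

Definition translate (X : zmodType) (A : set X) (x : X) : set X :=
  [set a + x | a in A].

Definition haar (X : topologicalZmodType) (I : set (set cantor_space))
    (A : set X) : Prop :=
  exists B : set X, [/\ borel B, A `<=` B &
    exists2 f : cantor_space -> X, continuous f &
      forall x : X, I (f @^-1` translate B x)].

(* Main.v *)
(** If [f] witnesses that a nonempty [B] is Haar-small, then every fibre of [f]
lies in the preimage of a translate of [B], hence is countable, so the compact
set [range f] is uncountable and contains a Cantor set [D]; the set
[(D - x) `&` B] is covered by the image of [f @^-1` (B + x)].  When [B] is empty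
any Cantor set in [X] will do.  Both Cantor sets come from the perfect set
theorem: an uncountable closed set has two condensation points, hence contains
two disjoint small uncountable closed sets, and iterating gives a Cantor scheme.
The remaining implications only use that [z] lies in
[\bigcap_(s in S) (B - s)] iff [S + z] is included in [B]. *)
Require Import Defs.
From mathcomp Require Import all_boot all_order all_algebra.
From mathcomp Require Import all_classical all_reals topology tvs cantor.
From mathcomp Require Import pseudometric_normed_Zmodule.

Local Open Scope classical_set_scope.
Local Open Scope ring_scope.

Import Order.TTheory GRing.Theory Num.Theory.

(** * Cantor space and its injective images *)

Lemma cantor_space_uncountable : ~ countable [set: cantor_space].
Proof.
move=> /countable_injP[f finj].
(* Diagonal sequence: at the code of [d] it takes the value opposite to that of [d], so it would
   differ from itself at its own code. *)
pose c : cantor_space := fun n =>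
  ~~ `[< exists2 d : cantor_space, f d = n & d n >].
have cE : c (f c) = ~~ c (f c).
  rewrite {1}/c; congr (~~ _); apply/asboolP/idP => [[d fdc]|cfc].
    by have -> : d = c by apply: finj; rewrite ?in_setT.
  by exists c.
by case: (c (f c)) cE.
Qed.

(** A continuous map from a compact space to a Hausdorff one is closed, so the inverse of [g] on its
    range is continuous. *)
Lemma cantor_set_range (T : topologicalType) (g : cantor_space -> T) :
  hausdorff_space T -> continuous g -> injective g -> cantor_set (range g).
Proof.
move=> hT cg ginj.
have gP c : g c \in range g by apply/mem_set; exists c.
have gV (y : range g) : {c | g c = set_val y}.
  by apply: cid; have /set_mem[c _ gc] := valP y; exists c.
have set_valc : continuous (set_val : range g -> T) by exact: initial_continuous.
exists (fun c => exist _ (g c) (gP c)), (fun y => sval (gV y)); split.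
- by apply: continuous_comp_initial.
- apply/continuous_closedP => C Ccl.
  have -> : (fun y => sval (gV y)) @^-1` C = set_val @^-1` (g @` C).
    apply/seteqP; split => [y Cy|y [c Cc gcy]] /=.
      by exists (sval (gV y)) => //; rewrite (svalP (gV y)).
    suff -> : sval (gV y) = c by [].
    by apply: ginj; rewrite gcy (svalP (gV y)).
  have cptC : compact C by apply: (subclosed_compact Ccl cantor_space_compact).
  move/continuous_closedP : set_valc; apply; apply: compact_closed => //.
  by apply: continuous_compact => //; exact: continuous_subspaceT.
- by move=> c; apply: ginj; rewrite (svalP (gV _)).
- by move=> y; apply: val_inj; rewrite /= (svalP (gV y)).
Qed.

(** * The perfect set theorem in complete separable metric spaces *)

Section perfect_set.
Context {R : realType} {M : metricType R}.
Implicit Types (A Q : set M) (e : R).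

Let natSinv_lt e : 0 < e -> exists n : nat, n.+1%:R^-1 < e.
Proof. by move=> /ltr_add_invr[n]; rewrite add0r; exists n. Qed.

(** Each such point lies in a ball with centre in [Q] and radius [n.+1%:R^-1] that meets [A] in a
    countable set; there are countably many such balls. *)
Lemma countable_non_condensation A Q : countable Q -> dense Q ->
  countable [set x | A x /\ exists2 e, 0 < e & countable (A `&` ball x e)].
Proof.
move=> cQ dQ.
pose P : set (M * nat) :=
  [set p | Q p.1 /\ countable (A `&` ball p.1 p.2.+1%:R^-1)].
have cP : countable P.
  apply: (@sub_countable _ _ P (Q `*` [set: nat])).
    by apply: subset_card_le => p [].
  exact: countableX.
apply: (@sub_countable _ _ _
    (\bigcup_(p in P) (A `&` ball p.1 p.2.+1%:R^-1))); last first.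
  by apply: bigcup_countable => // p [].
apply: subset_card_le => x [Ax [e e0 cAe]].
have [n ne] : exists n : nat, n.+1%:R^-1 < e / 2.
  by apply: natSinv_lt; rewrite divr_gt0.
have n0 : 0 < n.+1%:R^-1 :> R by rewrite invr_gt0.
have [q [xq Qq]] : (ball x n.+1%:R^-1)° `&` Q !=set0.
  apply: dQ; last exact: open_interior.
  by exists x; exact: nbhsx_ballx.
have {}xq := interior_subset xq.
exists (q, n) => /=; last by split => //; exact: ball_sym.
split => //; apply: sub_countable cAe.
apply: subset_card_le => y [Ay qy]; split => //.
apply: le_ball (ball_triangle xq qy).
by rewrite [e]splitr lerD// ltW.
Qed.

Lemma closed_uncountable_split A Q e : countable Q -> dense Q -> 0 < e ->
  closed A -> ~ countable A ->
  exists S : bool -> set M,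
    [/\ forall b, S b `<=` A /\ closed (S b) /\ ~ countable (S b),
        forall b x y, S b x -> S b y -> ball x e y &
        S true `&` S false = set0].
Proof.
move=> cQ dQ e0 Acl Ancnt.
(* The condensation points of [A]: all but countably many points of [A]. *)
pose cond := [set x | A x /\ forall e, 0 < e -> ~ countable (A `&` ball x e)].
have condnc : ~ countable cond.
  move=> cc; apply: Ancnt.
  have := countable_non_condensation A Q cQ dQ; set N := [set _ | _] => cN.
  have : countable (\bigcup_(b in [set: bool]) if b then cond else N).
    by apply: bigcup_countable => // -[].
  apply: sub_countable; apply: subset_card_le => x Ax.
  have [xN|xN] := pselect (N x); first by exists false.
  by exists true => //; split => // r r0 ?; apply: xN; split => //; exists r.
have [x cx] : cond !=set0.
  by apply/set0P/eqP => c0; apply: condnc; rewrite c0.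
have [y [cy yx]] : exists y, cond y /\ y <> x.
  apply: contrapT => xonly; apply: condnc.
  apply: (@sub_countable _ _ _ [set x]); last exact: countable1.
  apply: subset_card_le => y cy; apply: contrapT => yx.
  by apply: xonly; exists y.
have d0 : 0 < mdist x y by rewrite mdist_gt0; apply/eqP => xy; apply: yx.
(* The closed balls of radius [r / 2] lie in the open balls of radius [r]. As [r + r] is at most [e]
   and at most the distance from [x] to [y], they are small and disjoint. *)
pose r := Num.min e (mdist x y) / 2.
have r0 : 0 < r by rewrite divr_gt0// lt_min e0.
exists (fun b => A `&` closed_ball (if b then x else y) (r / 2)).
have r20 : 0 < r / 2 by rewrite divr_gt0.
split.
- move=> b; split; first by move=> ? [].
  split; first by apply: closedI => //; exact: closed_ball_closed.
  have [_ /(_ _ r20)] : cond (if b then x else y) by case: b.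
  apply: contra_not; apply: sub_countable; apply: subset_card_le.
  by apply: setIS; exact: subset_closed_ball.
- move=> b u v [_ /(subset_closure_half r0) bu] [_ /(subset_closure_half r0) bv].
  apply: le_ball (ball_triangle (ball_sym bu) bv).
  by rewrite -splitr ge_min lexx.
- rewrite -subset0 => z [[_ /(subset_closure_half r0) bx]].
  move=> [_ /(subset_closure_half r0) /ball_sym zy].
  have := ball_triangle bx zy; rewrite -splitr ballEmdist /=.
  by rewrite lt_min ltxx andbF.
Qed.

Lemma perfect_set_theorem A Q : complete_space M -> countable Q -> dense Q ->
  closed A -> ~ countable A ->
  exists g : cantor_space -> M, [/\ continuous g, injective g & range g `<=` A].
Proof.
move=> cM cQ dQ Acl Anc.
have [S SP] : exists S : set M -> nat -> bool -> set M, forall B n,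
    closed B -> ~ countable B ->
    [/\ forall b, S B n b `<=` B /\ closed (S B n b) /\ ~ countable (S B n b),
        forall b x y, S B n b x -> S B n b y -> ball x n.+1%:R^-1 y &
        S B n true `&` S B n false = set0].
  suff h (p : set M * nat) : exists S : bool -> set M,
    closed p.1 -> ~ countable p.1 ->
    [/\ forall b, S b `<=` p.1 /\ closed (S b) /\ ~ countable (S b),
        forall b x y, S b x -> S b y -> ball x p.2.+1%:R^-1 y &
        S true `&` S false = set0].
    have [S SP] := choice h.
    by exists (fun B n => S (B, n)) => B n; exact: (SP (B, n)).
  have [[pc pnc]|np] := pselect (closed p.1 /\ ~ countable p.1).
    have n0 : 0 < p.2.+1%:R^-1 :> R by rewrite invr_gt0.
    have [S SP] := closed_uncountable_split p.1 Q _ cQ dQ n0 pc pnc.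
    by exists S.
  (* A default value where there is nothing to split, so that [choice] yields a total function on
     which to recurse. *)
  by exists (fun=> set0) => ? ?; exfalso; apply: np.
(* The node at depth [n] of the Cantor scheme along the branch [c]; it depends only on the first [n]
   digits of [c]. *)
pose F (c : cantor_space) := fix F n := if n is m.+1 then S (F m) m (c m) else A.
have Fbig c n : closed (F c n) /\ ~ countable (F c n).
  by elim: n => //= n [cl nc]; have [/(_ (c n))[]] := SP _ n cl nc.
have Fsub c n : F c n.+1 `<=` F c n.
  by have [cl nc] := Fbig c n; have [/(_ (c n))[]] := SP _ n cl nc.
have Fsmall c n x y : F c n.+1 x -> F c n.+1 y -> ball x n.+1%:R^-1 y.
  by have [cl nc] := Fbig c n; have [_ + _] := SP _ n cl nc; apply.
have Fdec c m n : (m <= n)%N -> F c n `<=` F c m.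
  elim: n => [|n IH]; first by rewrite leqn0 => /eqP ->.
  rewrite leq_eqVlt => /predU1P[->//|/IH]; apply: subset_trans; exact: Fsub.
have Fn0 c n : F c n !=set0.
  by have [_ nc] := Fbig c n; apply/set0P/eqP => c0; apply: nc; rewrite c0.
(* The nodes along a branch generate a Cauchy filter; its limit [g c] lies in all of them, since
   they are closed and decreasing. *)
pose G c := filter_from [set: nat] (F c).
have GP c : ProperFilter (G c).
  apply: filter_from_proper => //; apply: filter_from_filter; first by exists 0%N.
  move=> i j _ _; exists (maxn i j) => // x Fx.
  by split; apply: Fdec Fx; rewrite ?leq_maxl ?leq_maxr.
have Gcauchy c : cauchy (G c).
  apply: cauchy_exP => e e0; have [n ne] := natSinv_lt _ e0.
  have [x Fx] := Fn0 c n.+1; exists x; exists n.+1 => // y Fy.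
  exact: le_ball (ltW ne) _ (Fsmall _ _ _ _ Fx Fy).
pose g c := sval (cid (cM _ (GP c) (Gcauchy c))).
have gF c n : F c n (g c).
  have [cl _] := Fbig c n; apply: cl => U.
  move=> /(svalP (cid (cM _ (GP c) (Gcauchy c)))) [m _ FU]; have [x Fx] := Fn0 c (maxn m n).
  exists x; split; first by apply: Fdec Fx; rewrite leq_maxr.
  by apply: FU; apply: Fdec Fx; rewrite leq_maxl.
exists g; split.
- move=> c U /nbhs_ballP[e /= e0 eU]; have [n ne] := natSinv_lt _ e0.
  (* Sequences near [c] share its first [k] digits, hence its node at depth [k]. *)
  have Fnear k : \forall c' \near c, F c' k = F c k.
    elim: k => [|k IH]; first by near=> c'.
    have ck : \forall c' \near c, c' k = c k.
      apply: (@proj_continuous _ (fun _ : nat => bool) k c [set b | b = c k]).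
      by [].
    by near=> c' => /=; rewrite (near IH c')// (near ck c').
  apply: filterS (Fnear n.+1) => c' Fc'; apply: eU.
  apply: le_ball (ltW ne) _ (Fsmall c n _ _ (gF _ _) _).
  by rewrite -Fc'.
- move=> c c' gcc'.
  (* Different digits would put the common point [g c] in two disjoint children of one node. *)
  have Fsep n : F c n = F c' n -> c n = c' n.
    move=> FE; have := gF c n.+1; have := gF c' n.+1; rewrite /= -gcc' -FE.
    have [cl nc] := Fbig c n; have [_ _] := SP _ n cl nc; rewrite -subset0.
    by move=> /(_ (g c)); case: (c n); case: (c' n) => // + S1 S2 => [[]].
  have FE n : F c n = F c' n.
    by elim: n => //= n IH; rewrite (Fsep _ IH) IH.
  by apply/funext => n; exact: Fsep.
- by move=> _ [c _ <-]; exact: (gF c 0%N).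
Unshelve. all: by end_near. Qed.

End perfect_set.

Lemma polish_hausdorff (R : realType) (T : topologicalType) :
  polish R T -> hausdorff_space T.
Proof.
move=> [_ [M _ [h [k [ch ck hk kh]]]]] x y cxy.
apply: (can_inj hk); apply: (@metric_hausdorff R M) => U V hxU hyV.
have [z [Uz Vz]] := cxy _ _ (ch _ _ hxU) (ch _ _ hyV).
by exists (h z).
Qed.

(** The perfect set theorem is applied in a metric copy of [T] and carried back by the
    homeomorphism. *)
Lemma polish_cantor_subset (R : realType) (T : topologicalType) (K : set T) :
  polish R T -> closed K -> ~ countable K ->
  exists2 D : set T, cantor_set D & D `<=` K.
Proof.
move=> polT clK ncK.
have [[Q cQ dQ] [M cM [h [k [ch ck hk kh]]]]] := polT.
have dhQ : dense (h @` Q).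
  move=> O [z Oz] Oop; have [||x [Ox Qx]] := dQ (h @^-1` O).
  - by exists (k z); rewrite /= kh.
  - by move/continuousP : ch; apply.
  - by exists (h x); split => //; exists x.
have chQ : countable (h @` Q) by exact: sub_countable (card_image_le _ _) cQ.
have clhK : closed (k @^-1` K) by move/continuous_closedP : ck; apply.
have nchK : ~ countable (k @^-1` K).
  move=> cK; apply: ncK; have : countable (k @` (k @^-1` K)).
    exact: sub_countable (card_image_le _ _) cK.
  apply: sub_countable; apply: subset_card_le => x Kx.
  by exists (h x); rewrite /= ?hk.
have [g [cg ginj gK]] := perfect_set_theorem _ _ cM chQ dhQ clhK nchK.
exists (range (k \o g)); last by move=> _ [c _ <-]; apply: gK; exists c.
apply: cantor_set_range; first exact: polish_hausdorff polT.
- by move=> c; apply: continuous_comp; [exact: cg|exact: ck].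
- by apply: inj_comp ginj; exact: can_inj kh.
Qed.

(** * Size bounds, and Cantor sets from Haar witnesses *)

Lemma sets_of_size_card_le (T U : Type) (alpha : size_bound) (A : set T)
    (B : set U) :
  (A #<= B)%card -> sets_of_size alpha B -> sets_of_size alpha A.
Proof.
move=> AB; case: alpha => [|| n] /=.
- exact: sub_countable AB.
- exact: card_le_finite AB.
- exact: card_le_trans AB.
Qed.

Lemma sets_of_size_countable (T : Type) (alpha : size_bound) (A : set T) :
  sets_of_size alpha A -> countable A.
Proof.
case: alpha => [//|| n] /=; first exact: finite_set_countable.
by move=> /card_le_finite/(_ (finite_II n))/finite_set_countable.
Qed.

Lemma sets_of_size0 (T : Type) (alpha : size_bound) :
  sets_of_size alpha (@set0 T).
Proof. by case: alpha => //=. Qed.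

Lemma haar_cantor_set (R : realType) (alpha : size_bound)
    (X : topologicalZmodType) (B : set X) :
  polish R X -> ~ countable [set: X] ->
  haar (@sets_of_size cantor_space alpha) B ->
  exists2 D : set X, cantor_set D &
    forall x : X, sets_of_size alpha (translate D (- x) `&` B).
Proof.
move=> polX ncX [B' [_ BB' [f cf fB']]].
have [B0|/set0P[b Bb]] := eqVneq B set0.
  have [D cD _] := polish_cantor_subset _ _ _ polX closedT ncX.
  by exists D => // x; rewrite B0 setI0; exact: sets_of_size0.
have [|nc|D cD Df] := polish_cantor_subset _ _ (range f) polX.
- apply: compact_closed; first exact: polish_hausdorff polX.
  apply: continuous_compact; first exact: continuous_subspaceT.
  exact: cantor_space_compact.
- apply: cantor_space_uncountable.
  (* Since [y = b + (y - b)] with [b] in [B'], the fibre over [y] lies in the preimage of the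
     translate by [y - b]. *)
  have : countable (\bigcup_(y in range f) f @^-1` translate B' (y - b)).
    apply: bigcup_countable => // y _.
    exact: sets_of_size_countable (fB' _).
  apply: sub_countable; apply: subset_card_le => c _.
  by exists (f c); [exists c|exists b; [exact: BB'|rewrite addrC subrK]].
- exists D => // x; apply: sets_of_size_card_le (fB' x).
  apply: (@card_le_trans _ _ _ ((fun c => f c - x) @` (f @^-1` translate B' x))).
    apply: subset_card_le => _ [[d Dd <-] Bdx]; have [c _ fcd] := Df _ Dd.
    exists c; last by rewrite fcd.
    by exists (d - x); [exact: BB'|rewrite subrK].
  exact: card_image_le.
Qed.

Theorem proposition1p2 (R : realType) (alpha : size_bound)
    (X : topologicalZmodType) (polishX : polish R X)
    (uncountableX : ~ countable [set: X]) (B : set X) (borelB : borel B) :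
  [<-> haar (@sets_of_size cantor_space alpha) B;
       exists2 D : set X, cantor_set D &
         forall x : X, @sets_of_size X alpha (translate D (- x) `&` B);
       exists2 D : set X, cantor_set D &
         forall S : set X, S `<=` D -> ~ @sets_of_size X alpha S ->
           \bigcap_(s in S) translate B (- s) = set0].
Proof.
tfae.
- exact: haar_cantor_set polishX uncountableX.
- move=> [D cD DB]; exists D => // S SD; apply: contra_notP.
  move=> /eqP/set0P[z zS].
  (* The set [S + z] lies in both [D + z] and [B], and translating it by [- z] gives back [S]. *)
  apply: sets_of_size_card_le (DB (- z)).
  apply: (@card_le_trans _ _ _
      ((fun y => y - z) @` (translate D (- - z) `&` B))); last first.
    exact: card_image_le.
  apply: subset_card_le => s Ss; have [b Bb bsz] := zS _ Ss.
  exists (s + z); last by rewrite addrK.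
  split; first by exists s; [exact: SD|rewrite opprK].
  by rewrite -bsz addrC subrK.
- move=> [D [f [g [cf cg fK gK]]] DB].
  (* [B] is its own Borel hull, and the parametrization of [D] is the witness. *)
  exists B; split => //; exists (set_val \o f).
    move=> c; apply: continuous_comp; first exact: cf.
    exact: initial_continuous.
  move=> x; apply: contrapT => nfB.
  have finj : injective (set_val \o f).
    by apply: inj_comp; [exact: val_inj|exact: can_inj fK].
  (* By injectivity, a large preimage of [B + x] makes its trace on [D] large. The intersection is
     then empty, yet it contains [- x]: for [s = b + x] one has [b - s = - x]. *)
  have DBx0 : \bigcap_(s in D `&` translate B x) translate B (- s) = set0.
    apply: DB; first exact: subIsetl.
    apply: contra_not nfB; apply: sets_of_size_card_le.
    have -> : (set_val \o f) @^-1` translate B x =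
              (set_val \o f) @^-1` (D `&` translate B x).
      apply/seteqP; split => c /=; last by case.
      by split => //; exact: set_mem (valP (f c)).
    by apply: card_ge_preimage => ? ? _ _ /finj.
  suff : set0 (- x) by [].
  rewrite -DBx0 => _ [_ [b Bb <-]].
  by exists b => //; rewrite opprD addNKr.
Qed.
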